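(* Let $n=\prod_{i=1}^t n_i$ where the $n_i$'s are pairwise coprime. For $a\in\mathbb{Z}$ the congruence $a^k\equiv s\pmod{n}$ with $s\in\{\pm1\}$ holds if and only if for every $i$, $a^k\equiv s\pmod{n_i}$. Consequently, $\left(\frac{a}{n}\right)_k=s\in\{\pm1\}$ if and only if the same sign $s$ occurs for each modulus $n_i$; otherwise $\left(\frac{a}{n}\right)_k=0$.
   Context: Here $n\ge 2$ and $k\ge 1$ are integers. For integers $n\ge 2$, $k\ge 1$ and $a\in\mathbb{Z}$, the exponential congruence symbol $\left(\frac{a}{n}\right)_k\in\{-1,0,1\}$ is defined to be $1$ if $a^k\equiv 1\pmod n$, $-1$ if $a^k\equiv -1\pmod n$, and $0$ otherwise.
   Formalization: Symbols take value 1 at modulus 2 when a is odd; as the claim then fails (a=5, k=1, n=2·3, s=−1), symbol equality is stated for s=1, n=2, or no n_i=2; otherwise ''sign s occurs for n_i'' means the symbol is congruent to s mod n_i. For the symbol part each n_i≥2. *)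

(* Defs.v *)
From mathcomp Require Import all_boot all_order all_algebra.

Set Implicit Arguments.
Unset Strict Implicit.
Unset Printing Implicit Defensive.

Import GRing.Theory.
Local Open Scope ring_scope.

(* The symbol (a/n)_k.  For n = 2 both congruences hold when a is odd; the
   clauses are tried in the given order, so that the value is then 1. *)
Definition expsym (k : nat) (a : int) (n : nat) : int :=
  if (a ^+ k == 1 %[mod n%:Z])%Z then 1
  else if (a ^+ k == -1 %[mod n%:Z])%Z then -1
  else 0.

(* Main.v *)
(* Divisibility by a product of pairwise coprime moduli is divisibility by each
   of them.  For a modulus m >= 2, the symbol is always congruent to a sign s
   exactly when a ^+ k is; it is equal to s under the same condition as soon as
   the signs are distinct mod m (m <> 2) or s = 1, the value tried first. *)
Require Import Defs.
From mathcomp Require Import all_boot all_order all_algebra.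

Set Implicit Arguments.
Unset Strict Implicit.
Unset Printing Implicit Defensive.

Import GRing.Theory.
Local Open Scope ring_scope.

Lemma dvdn_prod_coprime (I : eqType) (r : seq I) (F : I -> nat) (d : nat) :
    uniq r -> {in r &, forall i j, i != j -> coprime (F i) (F j)} ->
  (\prod_(i <- r) F i %| d)%N = all (fun i => F i %| d)%N r.
Proof.
elim: r => [|i r IHr] /=; first by rewrite big_nil dvd1n.
case/andP=> i_notin_r r_uniq cop; rewrite big_cons Gauss_dvd.
  by rewrite IHr // => x y xr yr; apply: cop; rewrite inE ?xr ?yr orbT.
(* Being coprime to [F i] is stable under products, so the head is coprime to the product of the
   tail; [uniq] makes the indices distinct. *)
rewrite big_seq; apply: (big_ind (coprime (F i))) => [|x y cx cy|j jr].
- exact: coprimen1.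
- by rewrite coprimeMr cx.
by apply: cop; rewrite ?inE ?eqxx ?jr ?orbT //; apply: contraNneq i_notin_r => ->.
Qed.

Lemma eqz_mod_prod_coprime (t : nat) (F : 'I_t -> nat) (x y : int) :
    (forall i j, i != j -> coprime (F i) (F j)) ->
  (x == y %[mod (\prod_(i < t) F i)%N%:Z])%Z =
  [forall i, (x == y %[mod (F i)%:Z])%Z].
Proof.
move=> cop; rewrite eqz_mod_dvd dvdzE dvdn_prod_coprime ?index_enum_uniq //.
  rewrite -[LHS]big_all big_andE; apply: eq_forallb => i.
  by rewrite eqz_mod_dvd dvdzE.
by move=> ? ? _ _; apply: cop.
Qed.

(** Keeps the default value 0 of the symbol apart from both signs: [m] would have to divide 1. *)
Lemma neq0_sign_modz (m : nat) (s : int) :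
  (2 <= m)%N -> s = 1 \/ s = -1 -> ~ (0 = s %[mod m%:Z])%Z.
Proof.
move=> m_ge2 hs /eqP; rewrite eqz_mod_dvd dvdzE => /dvdn_leq.
by case: hs => -> /= /(_ isT); rewrite leqNgt m_ge2.
Qed.

Lemma neq1N1_modz (m : nat) : (2 < m)%N -> ~ (1 = -1 %[mod m%:Z])%Z.
Proof.
move=> m_gt2 /eqP; rewrite eqz_mod_dvd dvdzE => /dvdn_leq /= /(_ isT).
by rewrite leqNgt m_gt2.
Qed.

Lemma expsym_mod_sign (k m : nat) (a s : int) :
    (2 <= m)%N -> s = 1 \/ s = -1 ->
  (expsym k a m = s %[mod m%:Z])%Z <-> (a ^+ k = s %[mod m%:Z])%Z.
Proof.
move=> m_ge2 hs; rewrite /expsym.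
have [->//|n1] := eqVneq; have [->//|nN1] := eqVneq.
split=> [/neq0_sign_modz[]//|e].
by case: hs e => -> /eqP; rewrite ?(negPf n1) ?(negPf nN1).
Qed.

Lemma expsym_sign (k m : nat) (a s : int) :
    (2 <= m)%N -> s = 1 \/ s = -1 -> s = 1 \/ m <> 2%N ->
  expsym k a m = s <-> (a ^+ k = s %[mod m%:Z])%Z.
Proof.
move=> m_ge2 hs hm; split=> [e|]; first by apply/expsym_mod_sign; rewrite ?e.
rewrite /expsym => e; case: hs hm e => -> hm e; first by rewrite e eqxx.
(* For [s = -1] the clause for 1 is tried first; it fails because [m > 2] would otherwise divide
   2. *)
have m_gt2 : (2 < m)%N by case: hm => // /eqP; rewrite ltn_neqAle eq_sym m_ge2 andbT.
by rewrite e eqxx; case: eqP => // /esym /(neq1N1_modz m_gt2).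
Qed.

Lemma expsym_cases (k m : nat) (a : int) :
  expsym k a m = 0 \/ exists2 s : int, s = 1 \/ s = -1 & expsym k a m = s.
Proof.
rewrite /expsym; case: ifP => _; first by right; exists 1; [left|].
by case: ifP => _; [right; exists (-1); [right|] | left].
Qed.

(* The signs 1 and -1 coincide modulo 2, and the equivalence between equalities
   of symbols fails for n = 2 * 3, a = 5, k = 1, s = -1.  The last two clauses
   of the second part therefore compare the symbols modulo n_ i: this is plain
   equality when n_ i > 2, and identifies 1 and -1 (but not 0) when n_ i = 2. *)
Theorem proposition2p11 (n k t : nat) (n_ : 'I_t -> nat) (a : int)
    (hn : (2 <= n)%N) (hk : (1 <= k)%N)
    (hprod : n = (\prod_(i < t) n_ i)%N)
    (hcop : forall i j : 'I_t, i != j -> coprime (n_ i) (n_ j)) :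
  (forall s : int, s = 1 \/ s = -1 ->
     ((a ^+ k = s %[mod n%:Z])%Z <->
      (forall i : 'I_t, (a ^+ k = s %[mod (n_ i)%:Z])%Z)))
  /\
  ((forall i : 'I_t, (2 <= n_ i)%N) ->
   [/\ forall s : int, s = 1 \/ s = -1 ->
         s = 1 \/ n = 2%N \/ (forall i : 'I_t, n_ i <> 2%N) ->
         (expsym k a n = s <-> (forall i : 'I_t, expsym k a (n_ i) = s)),
       n = 2%N \/ (forall i : 'I_t, n_ i <> 2%N) ->
       (forall s : int, s = 1 \/ s = -1 ->
          ~ (forall i : 'I_t, expsym k a (n_ i) = s)) ->
       expsym k a n = 0,
       forall s : int, s = 1 \/ s = -1 -> n <> 2%N ->
         (expsym k a n = s <->
          (forall i : 'I_t, (expsym k a (n_ i) = s %[mod (n_ i)%:Z])%Z))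
     & (forall s : int, s = 1 \/ s = -1 ->
          ~ (forall i : 'I_t, (expsym k a (n_ i) = s %[mod (n_ i)%:Z])%Z)) ->
       expsym k a n = 0]).
Proof.
have modP s : (a ^+ k = s %[mod n%:Z])%Z <->
    (forall i : 'I_t, (a ^+ k = s %[mod (n_ i)%:Z])%Z).
  rewrite hprod; split=> [/eqP|h]; last apply/eqP; rewrite eqz_mod_prod_coprime //.
    by move=> /forallP h i; apply/eqP.
  by apply/forallP=> i; apply/eqP.
split=> [s _|n_ge2]; first exact: modP.
have expsymP (s : int) : s = 1 \/ s = -1 ->
    s = 1 \/ n = 2%N \/ (forall i : 'I_t, n_ i <> 2%N) ->
    (expsym k a n = s <-> (forall i : 'I_t, expsym k a (n_ i) = s)).
  move=> hs hs2.
  (* An empty product would be 1, so some index exists; it recovers the symbol mod [n] from the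
     family when [n = 2]. *)
  have [i0 _] : exists i0 : 'I_t, true.
    case: t n_ hprod {modP hcop n_ge2 hs2} => [F|t' F _]; last by exists ord0.
    by rewrite big_ord0 => n1; move: hn; rewrite n1.
  have [n2|n_neq2] := eqVneq n 2%N.
    (* Each [n_ i] is at least 2 and divides [n = 2], so all the symbols coincide. *)
    have nE i : n_ i = n.
      apply/eqP; rewrite eqn_leq [X in _ && (X <= _)%N]n2 n_ge2 andbT.
      rewrite dvdn_leq ?(ltnW hn) // hprod (bigD1 i) //=.
      exact: dvdn_mulr.
    by split=> [e i|/(_ i0)]; rewrite nE.
  have hs3 : s = 1 \/ (forall i : 'I_t, n_ i <> 2%N).
    by case: hs2 => [|[e2|]]; [left | move: n_neq2; rewrite e2 | right].
  apply: (iff_trans (expsym_sign k a hn hs _)); first by right; apply/eqP.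
  apply: (iff_trans (modP s)); split=> h i; apply/expsym_sign=> //.
  - by case: hs3 => [|/(_ i)]; [left|right].
  - by case: hs3 => [|/(_ i)]; [left|right].
split=> // [n2 no_s|s hs n_neq2|no_s].
- case: (expsym_cases k n a) => // -[s hs e]; case: (no_s s hs).
  by apply/(expsymP s hs); [right|].
- apply: (iff_trans (expsym_sign k a hn hs _)); first by right.
  by apply: (iff_trans (modP s)); split=> h i; apply/expsym_mod_sign.
(* A nonzero symbol mod [n] is a sign [s], and [a ^+ k] is then congruent to [s] modulo every
   [n_ i], even when 2 occurs among them. *)
case: (expsym_cases k n a) => // -[s hs e]; case: (no_s s hs) => i.
apply/expsym_mod_sign=> //; move: i; apply/modP.
by apply/(expsym_mod_sign k a hn hs); rewrite e.
Qed.
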